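(* Let $V_h\subset V$ and $W_h\subset L^\infty(\Omega_d;\mathbb{R}^m)\subset L^2(\Omega_d;\mathbb{R}^m)$ be finite-dimensional subspaces satisfying the discrete inf-sup condition $$\inf_{w\in W_h}\sup_{v\in V_h}\frac{b(v,w)}{\|v\|_V\,\|w\|_{Q'}}=\mu_h>\mu_0>0 ,$$ where $\mu_0$ is a mesh-independent constant. Let $\psi_h^0\in W_h$ and let $\{\alpha_k\}_{k\ge1}$ be a sequence of positive real numbers. Then for every $k\ge 1$ there exists a unique pair $(u_h^k,\psi_h^k)\in V_h\times W_h$ such that $$\alpha_k\,\mathcal{A}(u_h^k,v_h)+b(v_h,\psi_h^k-\psi_h^{k-1})=\alpha_k F(v_h)\quad\text{for all }v_h\in V_h,$$ $$b(u_h^k,w_h)-(\nabla\mathcal{R}^*(\psi_h^k),w_h)_{\Omega_d}=0\quad\text{for all }w_h\in W_h$$ (where, for $k\geq 2$, $\psi_h^{k-1}$ is the latent variable from the previous step).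
   Context: **Variational setting.** $\Omega\subset\mathbb{R}^n$ ($n=1,2,3$) is a bounded Lipschitz domain; $\Omega_d\subset\overline\Omega$ is a Hausdorff-measurable set of dimension $d\le n$, with measure $\mathrm{d}\mathcal{H}_d$; $(\cdot,\cdot)_{\Omega_d}$ is the $L^2(\Omega_d;\mathbb{R}^m)$ inner product. $V$ is a real Hilbert space, $\mathcal{L}:V\to V'$ is linear, $F\in V'$, and $\mathcal{A}(u,v)=\langle\mathcal{L}u,v\rangle$ (not necessarily symmetric). Put $\mathcal{A}_0(u,v)=\tfrac12(\mathcal{A}(u,v)+\mathcal{A}(v,u))$ and $\mathcal{A}_n(u,v)=\tfrac12(\mathcal{A}(u,v)-\mathcal{A}(v,u))$. It is assumed that for all $u,v\in V$: $\mathcal{A}_n(u,v)\le c_1\|u\|_V\|v\|_V$, $\mathcal{A}_0(u,v)\le C_{\mathrm{bnd}}\|u\|_V\|v\|_V$, and $\mathcal{A}(u,u)\ge C_{\mathrm{coerc}}\|u\|_V^2$, with $c_1\ge0$, $C_{\mathrm{bnd}},C_{\mathrm{coerc}}>0$. $B:V\to Q$ is a bounded linear map with image $Q=\operatorname{im}B$, where $Q$ is a Banach space continuously and densely embedded in $L^2(\Omega_d;\mathbb{R}^m)$. Set $b(v,w)=(Bv,w)_{\Omega_d}$. A function $w\in L^2(\Omega_d;\mathbb{R}^m)$ is regarded as an element of $Q'$ via $q\mapsto(w,q)_{\Omega_d}$, and $\|w\|_{Q'}$ is the corresponding dual norm. **Constraint and Legendre function.** For a.e. $x\in\Omega_d$,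 $C(x)\subset\mathbb{R}^m$ is a closed convex set with nonempty interior, and $\mathcal{O}=\{o\in L^2(\Omega_d;\mathbb{R}^m): o(x)\in C(x)\text{ for a.e. }x\in\Omega_d\}$. A (closed convex) function $L:\mathbb{R}^m\to\mathbb{R}\cup\{+\infty\}$ is a Legendre function if it is proper with $\operatorname{int}(\operatorname{dom}L)\neq\emptyset$, strictly convex and differentiable on $\operatorname{int}(\operatorname{dom}L)$, and has a singular gradient on the boundary of $\operatorname{dom}L$ ($|\nabla L(y_j)|\to\infty$ when $y_j\in\operatorname{int}(\operatorname{dom} L)$ tends to a boundary point). $R:\Omega_d\times\mathbb{R}^m\to\mathbb{R}\cup\{+\infty\}$ is a Carathéodory function such that for a.e. $x$, $R(x,\cdot)$ is a Legendre function with $\operatorname{dom}R(x,\cdot)=C(x)$ which is supercoercive: $R(x,y)/|y|\to\infty$ as $|y|\to\infty$. $R^*(x,\cdot)$ is the convex conjugate of $R(x,\cdot)$, and $\nabla\mathcal{R}^*(\psi)(x)=\partial_zR^*(x,\psi(x))$. Standing convention: $\nabla\mathcal{R}^*$ is well defined and continuous on $L^\infty(\Omega_d;\mathbb{R}^m)$ and maps $L^\infty(\Omega_d;\mathbb{R}^m)$ into $\mathcal{O}\subset L^2(\Omega_d;\mathbb{R}^m)$. *)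

(* Defs.v *)
From HB Require Import structures.
From mathcomp Require Import all_boot all_order all_algebra.
From mathcomp Require Import all_classical all_reals all_analysis.
From mathcomp Require Import measurable_realfun.

Set Implicit Arguments.
Unset Strict Implicit.
Unset Printing Implicit Defensive.
Import Order.TTheory GRing.Theory Num.Theory.
Import numFieldNormedType.Exports.

Local Open Scope classical_set_scope.
Local Open Scope ring_scope.

(* The library norm on ['rV[R]_m] is the sup norm: the Euclidean structure is
   introduced here, while topological notions do not depend on the norm. *)
Section euclidean.
Context {R : realType} {m : nat}.
Implicit Types (x y : 'rV[R]_m).

Definition dotv x y : R := \sum_(i < m) x ord0 i * y ord0 i.

Definition enorm x : R := Num.sqrt (dotv x x).

Definition grad (f : 'rV[R]_m -> R^o) x : 'rV[R]_m :=
  \row_i 'D_(delta_mx ord0 i) f x.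

End euclidean.

Section lipschitz_domain.
Context {R : realType} {n : nat}.

(* Near each boundary point, Omega is the strict epigraph, in the direction of
   a unit vector e, of a Lipschitz function on the hyperplane orthogonal to e;
   [x - dotv x e *: e] is the orthogonal projection of x on that hyperplane. *)
Definition lipschitz_boundary (Omega : set 'rV[R]_n) :=
  forall p, (closure Omega `\` interior Omega) p ->
  exists (e : 'rV[R]_n) (g : 'rV[R]_n -> R^o),
    [/\ dotv e e = 1, [lipschitz g y | y in [set y | dotv y e = 0]] &
      \forall x \near p, Omega x <-> g (x - dotv x e *: e) < dotv x e].

Definition bounded_lipschitz_domain (Omega : set 'rV[R]_n) :=
  [/\ open Omega, connected Omega, Omega !=set0, bounded_set Omega &
      lipschitz_boundary Omega].

End lipschitz_domain.

Section hausdorff_measure.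
Context {R : realType} {n : nat}.
Local Notation E := 'rV[R]_n.

Definition euler_gamma (s : R) : R :=
  \int[lebesgue_measure]_(t in `]0, +oo[) (t `^ (s - 1) * expR (- t)).

(* For d integer, the volume of a Euclidean d-ball of diameter 1, so that the
   d-dimensional Hausdorff measure in R^d is the Lebesgue measure. *)
Definition hausdorff_cst (d : R) : R :=
  pi `^ (d / 2) / (2 `^ d * euler_gamma (d / 2 + 1)).

Definition diam (U : set E) : \bar R :=
  ereal_sup [set (enorm (p.1 - p.2))%:E | p in U `*` U].

(* Sets of diameter larger than delta get the value +oo, which excludes them
   from the coverings below; the empty set is separated because diam set0 = -oo
   and because 0 `^ 0 = 1. *)
Definition hausdorff_gauge (d delta : R) (U : set E) : \bar R :=
  if `[< U = set0 >] then 0%E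
  else if (diam U <= delta%:E)%E then ((hausdorff_cst d)%:E * diam U `^ d)%E
  else +oo%E.

Definition hausdorff_pre (d delta : R) (A : set E) : \bar R :=
  ereal_inf [set (\sum_(k <oo) hausdorff_gauge d delta (F k))%E |
             F in [set F : (set E)^nat | A `<=` \bigcup_k F k]].

Definition hausdorff (d : R) (A : set E) : \bar R :=
  ereal_sup [set hausdorff_pre d delta A | delta in [set delta | 0 < delta]].

Lemma hausdorff_cst_ge0 d : 0 <= hausdorff_cst d.
Proof.
rewrite /hausdorff_cst divr_ge0 ?powR_ge0// mulr_ge0 ?powR_ge0//.
by apply: Rintegral_ge0 => t _; rewrite mulr_ge0 ?powR_ge0 ?expR_ge0.
Qed.

Lemma hausdorff_gauge0 d delta : hausdorff_gauge d delta set0 = 0%E.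
Proof. by rewrite /hausdorff_gauge; case: asboolP. Qed.

Lemma hausdorff_gauge_ge0 d delta U : (0 <= hausdorff_gauge d delta U)%E.
Proof.
rewrite /hausdorff_gauge; case: asboolP => // _; case: ifPn => // _.
by rewrite mule_ge0 ?lee_fin ?hausdorff_cst_ge0 ?poweR_ge0.
Qed.

Lemma hausdorff_pre_mu_ext d delta :
  hausdorff_pre d delta = @mu_ext _ (g_sigma_algebraType [set: set E]) _
    (hausdorff_gauge d delta).
Proof.
apply/funext => A; rewrite /hausdorff_pre /mu_ext; congr ereal_inf.
apply/seteqP; split => _ [F AF <-]; last by exists F => //; case: AF.
by exists F => //; split => // i; exact: sub_gen_smallest.
Qed.

Lemma hausdorff_pre_le d delta A : 0 < delta ->
  (hausdorff_pre d delta A <= hausdorff d A)%E.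
Proof. by move=> d0; apply: ereal_sup_ubound; exists delta. Qed.

Lemma hausdorff0 d : hausdorff d set0 = 0%E.
Proof.
rewrite /hausdorff; apply/eqP; rewrite eq_le; apply/andP; split.
  apply: ge_ereal_sup => _ [delta _ <-].
  by rewrite hausdorff_pre_mu_ext mu_ext0//;
    [exact: hausdorff_gauge0|exact: hausdorff_gauge_ge0].
apply: (le_trans _ (hausdorff_pre_le _ _ ltr01)).
by rewrite hausdorff_pre_mu_ext mu_ext_ge0//; exact: hausdorff_gauge_ge0.
Qed.

Lemma hausdorff_ge0 d A : (0 <= hausdorff d A)%E.
Proof.
apply: (le_trans _ (hausdorff_pre_le _ _ ltr01)).
by rewrite hausdorff_pre_mu_ext mu_ext_ge0//; exact: hausdorff_gauge_ge0.
Qed.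

Lemma le_hausdorff d : {homo hausdorff d : A B / A `<=` B >-> (A <= B)%E}.
Proof.
move=> A B AB; apply: ge_ereal_sup => _ [delta /= d0 <-].
apply: le_trans (hausdorff_pre_le d B d0).
by rewrite hausdorff_pre_mu_ext; exact: le_mu_ext.
Qed.

Lemma hausdorff_sigma_subadditive d : sigma_subadditive (hausdorff d).
Proof.
move=> F; apply: ge_ereal_sup => _ [delta /= d0 <-].
rewrite hausdorff_pre_mu_ext.
apply: le_trans (mu_ext_sigma_subadditive _ _) _.
  exact: hausdorff_gauge_ge0.
rewrite -hausdorff_pre_mu_ext; apply: lee_nneseries => i _ //.
  by rewrite hausdorff_pre_mu_ext mu_ext_ge0//; exact: hausdorff_gauge_ge0.
exact: hausdorff_pre_le.
Qed.

HB.instance Definition _ d := isOuterMeasure.Build R E (hausdorff d)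
  (hausdorff0 d) (hausdorff_ge0 d) (@le_hausdorff d)
  (@hausdorff_sigma_subadditive d).

Definition hausdorff_dim (A : set E) : \bar R :=
  ereal_inf [set s%:E | s in [set s | 0 <= s /\ hausdorff s A = 0%E]].

End hausdorff_measure.

Definition hausdorff_outer (R : realType) (n : nat) (d : R) :
  {outer_measure set 'rV[R]_n -> \bar R} := @hausdorff R n d.

(* R^n with the sigma-algebra of the Hausdorff-measurable sets. *)
Notation hspace R n d := (caratheodory_type (@hausdorff_outer R n d)).

Definition hmeasure (R : realType) (n : nat) (d : R) :
    {measure set (hspace R n d) -> \bar R} :=
  (hausdorff_outer n d : set (hspace R n d) -> \bar R).

Section convex_analysis.
Context {R : realType} {m : nat}.
Implicit Types (f : 'rV[R]_m -> \bar R) (y z : 'rV[R]_m).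

Definition edom f : set 'rV[R]_m := [set y | (f y < +oo)%E].

Definition econvex f := forall y z (t : R), 0 <= t <= 1 ->
  (f (t *: y + (1 - t) *: z)%R <= t%:E * f y + (1 - t)%:E * f z)%E.

Record legendre f : Prop := Legendre {
  legendre_gtNy : forall y, f y != -oo%E ;
  legendre_convex : econvex f ;
  legendre_closed : lower_semicontinuous f ;
  legendre_proper : edom f !=set0 ;
  legendre_int_dom : interior (edom f) !=set0 ;
  legendre_strictly_convex : forall y z (t : R),
    interior (edom f) y -> interior (edom f) z -> y != z -> 0 < t < 1 ->
    (f (t *: y + (1 - t) *: z)%R < t%:E * f y + (1 - t)%:E * f z)%E ;
  legendre_differentiable : forall y, interior (edom f) y ->
    differentiable (fine \o f : 'rV[R]_m -> R^o) y ;
  legendre_singular : forall (y : nat -> 'rV[R]_m) y0,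
    (forall j, interior (edom f) (y j)) ->
    (closure (edom f) `\` interior (edom f)) y0 -> y @ \oo --> y0 ->
    enorm (grad (fine \o f) (y j)) @[j --> \oo] --> +oo }.

Definition supercoercive f := forall M : R, exists2 r : R, 0 < r &
  forall y, r < enorm y -> (M%:E < f y * (enorm y)^-1%:E)%E.

Definition conjugate f z : \bar R :=
  ereal_sup [set ((dotv z y)%:E - f y)%E | y in [set: 'rV[R]_m]].

End convex_analysis.

Definition fin_dim_subspace (R : realType) (V : lmodType R) (S : set V) :=
  exists (N : nat) (e : 'I_N -> V),
    S = [set \sum_i c i *: e i | c in [set: 'I_N -> R]].

(* R^m-valued functions on a measurable set D are represented by total
   functions, whose values outside D are irrelevant; elements of L^p are
   identified through almost everywhere equality on D. *)
Section Lp_spaces.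
Context d (T : measurableType d) (R : realType).
Variables (mu : {measure set T -> \bar R}) (D : set T) (m : nat).
Implicit Types (f g : T -> 'rV[R]_m) (p : \bar R).

Definition Lp_norm p f : \bar R := 'N[mu]_p[(EFin \o enorm \o f) \_ D]%E.

Definition Lp p f :=
  (forall i, measurable_fun D (fun x => f x ord0 i)) /\ (Lp_norm p f < +oo)%E.

Definition L2_inner f g : R := \int[mu]_(x in D) dotv (f x) (g x).

Definition fin_dim_Lp_subspace p (W : set (T -> 'rV[R]_m)) :=
  exists (N : nat) (e : 'I_N -> T -> 'rV[R]_m), (forall i, Lp p (e i)) /\
    W = [set f | Lp p f /\
                 exists c : 'I_N -> R, f = \sum_i c i *: e i %[ae mu in D]].

Section embedding.
Variables (Q : normedModType R) (iota : Q -> T -> 'rV[R]_m).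

Record continuous_dense_L2_embedding : Prop := L2Embedding {
  L2emb_L2 : forall q, Lp 2%:E (iota q) ;
  L2emb_linear : forall (a : R) q1 q2,
    iota (a *: q1 + q2) = a *: iota q1 + iota q2 %[ae mu in D] ;
  L2emb_inj : forall q1 q2, iota q1 = iota q2 %[ae mu in D] -> q1 = q2 ;
  L2emb_continuous : exists M : R,
    forall q, (Lp_norm 2%:E (iota q) <= (M * `|q|)%:E)%E ;
  L2emb_dense : forall f (eps : R), Lp 2%:E f -> 0 < eps ->
    exists q, (Lp_norm 2%:E (f - iota q)%R < eps%:E)%E }.

Definition dualQ_norm f : R :=
  sup [set `|L2_inner f (iota q)| / `|q| | q in [set q | q != 0]].

Definition inf_sup (V : normedModType R) (B : V -> Q) (Vh : set V)
    (Wh : set (T -> 'rV[R]_m)) : \bar R :=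
  ereal_inf [set
    ereal_sup [set (L2_inner (iota (B v)) w / (`|v| * dualQ_norm w))%:E |
               v in [set v | Vh v /\ v != 0]] |
    w in [set w | Wh w /\ ~ (w = (0 : T -> 'rV[R]_m) %[ae mu in D])]].

End embedding.

(* Since Rf x is +oo off its domain, continuity in the second variable is
   relative to this domain. *)
Definition caratheodory_function (Rf : T -> 'rV[R]_m -> \bar R) :=
  (forall y, measurable_fun D (fun x => Rf x y)) /\
  (\forall x \ae mu, D x -> {within edom (Rf x), continuous (Rf x)}).

Definition feasible (C : T -> set 'rV[R]_m) : set (T -> 'rV[R]_m) :=
  [set o | Lp 2%:E o /\ \forall x \ae mu, D x -> C x (o x)].

Definition grad_conj (Rf : T -> 'rV[R]_m -> \bar R) f : T -> 'rV[R]_m :=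
  fun x => grad (fine \o conjugate (Rf x)) (f x).

Record grad_conj_convention (Rf : T -> 'rV[R]_m -> \bar R)
    (C : T -> set 'rV[R]_m) : Prop := GradConjConvention {
  grad_conj_wd : forall f, Lp +oo%E f -> \forall x \ae mu, D x ->
    differentiable (fine \o conjugate (Rf x) : 'rV[R]_m -> R^o) (f x) ;
  grad_conj_feasible : forall f, Lp +oo%E f -> feasible C (grad_conj Rf f) ;
  grad_conj_continuous : forall f (eps : R), Lp +oo%E f -> 0 < eps ->
    exists2 delta : R, 0 < delta & forall g, Lp +oo%E g ->
      (Lp_norm +oo%E (g - f)%R < delta%:E)%E ->
      (Lp_norm 2%:E (grad_conj Rf g - grad_conj Rf f)%R < eps%:E)%E }.

Record proximal_step (V : normedModType R) (Q : normedModType R)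
    (iota : Q -> T -> 'rV[R]_m) (B : V -> Q) (A : V -> V -> R) (F : V -> R)
    (Rf : T -> 'rV[R]_m -> \bar R)
    (Vh : set V) (Wh : set (T -> 'rV[R]_m)) (alpha : R)
    (psi_prev : T -> 'rV[R]_m) (u : V) (psi : T -> 'rV[R]_m) : Prop :=
  ProximalStep {
  step_Vh : Vh u ;
  step_Wh : Wh psi ;
  step_primal : forall v, Vh v ->
    alpha * A u v + L2_inner (iota (B v)) (psi - psi_prev) = alpha * F v ;
  step_latent : forall w, Wh w ->
    L2_inner (iota (B u)) w - L2_inner (grad_conj Rf psi) w = 0 }.

End Lp_spaces.

(* Main.v *)
(* The primal equation determines u_h affinely in psi_h, by coercivity of A on
   V_h. Substituting it in the latent equation leaves, in coordinates on W_h,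
   an equation S x + G x = r in x alone. Here G, the map psi |-> grad R^*(psi)
   tested against W_h, is continuous and monotone, each R^*(x, .) being finite
   and convex; S = B^T A^-1 B is positive definite, because A is coercive and
   the inf-sup condition makes B^T injective. A continuous strongly monotone map
   of R^N has a zero: this is proved by induction on the number of coordinates,
   from the intermediate value theorem, which avoids Brouwer's theorem and any
   symmetry of A. Uniqueness follows by testing the difference of two solutions
   with itself. *)
Require Import Defs.
From HB Require Import structures.
From mathcomp Require Import all_boot all_order all_algebra.
From mathcomp Require Import all_classical all_reals all_analysis.
From mathcomp Require Import measurable_realfun.
From mathcomp Require Import ess_sup_inf.
From mathcomp Require Import ring lra.
Set Implicit Arguments.
Unset Strict Implicit.
Unset Printing Implicit Defensive.
Import Order.TTheory GRing.Theory Num.Theory.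
Import numFieldNormedType.Exports.
Local Open Scope classical_set_scope.
Local Open Scope ring_scope.

(** * The Euclidean inner product and norm on row vectors *)

Section dot_product.
Context {R : realType} {m : nat}.
Implicit Types (x y z : 'rV[R]_m) (a : R).

Lemma dotvC x y : dotv x y = dotv y x.
Proof. by apply: eq_bigr => i _; rewrite mulrC. Qed.

Lemma dotvDl x y z : dotv (x + y) z = dotv x z + dotv y z.
Proof. by rewrite -big_split; apply: eq_bigr => i _; rewrite mxE mulrDl. Qed.

Lemma dotvZl a x y : dotv (a *: x) y = a * dotv x y.
Proof. by rewrite mulr_sumr; apply: eq_bigr => i _; rewrite mxE mulrA. Qed.

Lemma dotvDr x y z : dotv x (y + z) = dotv x y + dotv x z.
Proof. by rewrite dotvC dotvDl !(dotvC x). Qed.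

Lemma dotvZr a x y : dotv x (a *: y) = a * dotv x y.
Proof. by rewrite dotvC dotvZl dotvC. Qed.

Lemma dotvNl x y : dotv (- x) y = - dotv x y.
Proof. by rewrite -scaleN1r dotvZl mulN1r. Qed.

Lemma dotvNr x y : dotv x (- y) = - dotv x y.
Proof. by rewrite dotvC dotvNl dotvC. Qed.

Lemma dotv0l y : dotv 0 y = 0.
Proof. by rewrite -(scale0r 0) dotvZl mul0r. Qed.

Lemma dotv_ge0 x : 0 <= dotv x x.
Proof. by apply: sumr_ge0 => i _; rewrite -expr2 sqr_ge0. Qed.

Lemma sqr_coord_le_dotv x i : x ord0 i ^+ 2 <= dotv x x.
Proof.
rewrite /dotv (bigD1 i)//= -expr2 lerDl.
by apply: sumr_ge0 => j _; rewrite -expr2 sqr_ge0.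
Qed.

Lemma dotv_eq0 x : dotv x x = 0 -> x = 0.
Proof.
move=> x0; apply/rowP => i; rewrite mxE; apply/eqP.
by rewrite -sqrf_eq0 eq_le sqr_ge0 andbT -x0 sqr_coord_le_dotv.
Qed.

Lemma enorm_ge0 x : 0 <= enorm x.
Proof. exact: sqrtr_ge0. Qed.

Lemma sqr_enorm x : enorm x ^+ 2 = dotv x x.
Proof. by rewrite sqr_sqrtr ?dotv_ge0. Qed.

Lemma enorm0 : enorm (0 : 'rV[R]_m) = 0.
Proof. by rewrite /enorm dotv0l sqrtr0. Qed.

Lemma enorm_eq0 x : (enorm x == 0) = (x == 0).
Proof.
apply/eqP/eqP => [x0|->]; last exact: enorm0.
by apply: dotv_eq0; rewrite -sqr_enorm x0 expr0n.
Qed.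

Lemma coord_le_enorm x i : `|x ord0 i| <= enorm x.
Proof. by rewrite -sqrtr_sqr ler_wsqrtr// sqr_coord_le_dotv. Qed.

Lemma norm_le_enorm x : `|x| <= enorm x.
Proof.
rewrite /Num.norm/= mx_normrE; apply/bigmax_leP; split=> [|[i j] _/=].
  exact: enorm_ge0.
by rewrite ord1 coord_le_enorm.
Qed.

Lemma dotv_le_sum x y : `|dotv x y| <= (\sum_i `|x ord0 i|) * enorm y.
Proof.
rewrite (le_trans (ler_norm_sum _ _ _))// mulr_suml ler_sum// => i _.
by rewrite normrM ler_wpM2l ?coord_le_enorm.
Qed.

Lemma enormZ a x : enorm (a *: x) = `|a| * enorm x.
Proof.
by rewrite /enorm dotvZl dotvZr mulrA -expr2 sqrtrM ?sqr_ge0// sqrtr_sqr.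
Qed.

Lemma dotv_normalize x : x != 0 ->
  dotv ((enorm x)^-1 *: x) ((enorm x)^-1 *: x) = 1.
Proof.
rewrite -enorm_eq0 => x0; rewrite -sqr_enorm enormZ normfV.
by rewrite ger0_norm ?enorm_ge0// mulVf// expr1n.
Qed.

(** Cauchy-Schwarz, from the nonnegative square of [enorm y *: x - enorm x *: y]. *)
Lemma dotv_le_enorm x y : dotv x y <= enorm x * enorm y.
Proof.
have [->|x0] := eqVneq x 0; first by rewrite dotv0l enorm0 mul0r.
have [->|y0] := eqVneq y 0; first by rewrite dotvC dotv0l enorm0 mulr0.
have := dotv_ge0 (enorm y *: x - enorm x *: y).
rewrite !(dotvDl, dotvDr, dotvNl, dotvNr, dotvZl, dotvZr) (dotvC y x).
rewrite -!sqr_enorm => h.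
have {}h : enorm x * enorm y * dotv x y <=
    enorm x * enorm y * (enorm x * enorm y) by nra.
rewrite -(ler_pM2l (_ : 0 < enorm x * enorm y))//.
by rewrite mulr_gt0// lt_neqAle eq_sym enorm_eq0 ?x0 ?y0 enorm_ge0.
Qed.

Lemma enormD x y : enorm (x + y) <= enorm x + enorm y.
Proof.
rewrite -(@ler_pXn2r _ 2)// ?nnegrE ?addr_ge0 ?enorm_ge0//.
rewrite sqrrD !sqr_enorm dotvDl !dotvDr (dotvC y x).
by have := dotv_le_enorm x y; lra.
Qed.

Lemma cvg_coord (T : Type) (F : set_system T) (FF : Filter F)
    (f : T -> 'rV[R]_m) x i :
  f @ F --> x -> f t ord0 i @[t --> F] --> x ord0 i.
Proof.
by move=> fx; exact: (cvg_comp _ _ fx (@coord_continuous _ _ _ _ _ x)).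
Qed.

Lemma continuous_dotv (T : topologicalType) (f g : T -> 'rV[R]_m) :
  continuous f -> continuous g -> continuous (fun t => dotv (f t) (g t)).
Proof.
move=> cf cg t; apply: cvg_big => [|i _]; first exact: add_continuous.
by apply: cvgM; apply: cvg_coord; [exact: cf|exact: cg].
Qed.

Lemma continuous_enorm : continuous (@enorm R m).
Proof.
move=> x; apply: (@continuous_comp _ _ _ (fun y => dotv y y)).
  by apply: continuous_dotv => z; exact: cvg_id.
exact: sqrt_continuous.
Qed.

End dot_product.

(** * Zeros of continuous strongly monotone maps of R^N *)

Section strongly_monotone.
Context {R : realType} {N : nat}.
Variables (T : 'rV[R]_N -> 'rV[R]_N) (c : R).
Hypotheses (cT : continuous T) (c0 : 0 < c).
Hypothesis monoT : forall x y,
  c * dotv (x - y) (x - y) <= dotv (T x - T y) (x - y).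

(** Only the coordinates of [x0] from [k] on matter: they are parameters of the first [k]
    equations. *)
Let partial_zero k (x0 x : 'rV[R]_N) :=
  (forall i : 'I_N, (k <= i)%N -> x ord0 i = x0 ord0 i) /\
  (forall i : 'I_N, (i < k)%N -> T x ord0 i = 0).

(** Below [k] both [T x] and [T y] vanish, and from [k] on [v - y] does, so [T x] may replace [T y]
    in the pairing with [v - y]. Strong monotonicity then controls the error of a guess [v] for the
    partial solution [y], although [x] solves the equations for other parameters. *)
Lemma partial_zero_dist k x0 x y0 y (v : 'rV[R]_N) : partial_zero k x0 x ->
  partial_zero k y0 y -> (forall i : 'I_N, (k <= i)%N -> v ord0 i = y ord0 i) ->
  enorm (v - y) <= enorm (T v - T x) / c.
Proof.
move=> [_ Tx] [_ Ty] vy.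
rewrite ler_pdivlMr// -(@ler_pXn2r _ 2)// ?nnegrE ?mulr_ge0 ?enorm_ge0//;
  last exact: ltW.
rewrite exprMn !sqr_enorm.
have := monoT v y.
have -> : dotv (T v - T y) (v - y) = dotv (T v - T x) (v - y).
  apply: eq_bigr => i _; rewrite !mxE.
  have [ik|ki] := ltnP i k; first by rewrite Tx// Ty.
  by rewrite vy// subrr !mulr0.
move: (v - y) (T v - T x) => e q h; rewrite mulrC.
(* With e = v - y and q = T v - T x, expanding |q - c e|^2 >= 0 gives |q|^2 >= 2 c q.e - c^2 |e|^2,
   and the right-hand side is at least c^2 |e|^2 because q.e >= c |e|^2. *)
have := dotv_ge0 (q - c *: e).
rewrite !(dotvDl, dotvDr, dotvNl, dotvNr, dotvZl, dotvZr) (dotvC e q) => h2.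
have h3 := ler_wpM2l (ltW c0) h. by lra.
Qed.

(* If T is solved in the first k coordinates for every value s of the next one,
   the solution X s is continuous in s, and what is left is a strongly monotone
   scalar equation in s. *)
Lemma partial_zero_exists k x0 : (k <= N)%N -> exists x, partial_zero k x0 x.
Proof.
elim: k x0 => [x0 _|k IH x0 kN]; first by exists x0; split.
pose i0 := Ordinal kN; pose e : 'rV[R]_N := delta_mx ord0 i0.
(* The parameter vector is [x0] with its coordinate [k] reset to [s]. *)
have [X PX] := choice (fun s : R => IH (x0 + (s - x0 ord0 i0) *: e) (ltnW kN)).
have Xi0 s : X s ord0 i0 = s.
  rewrite (PX s).1//= !mxE !eqxx mulr1; lra.
have Xgt s (i : 'I_N) : (k < i)%N -> X s ord0 i = x0 ord0 i.
  move=> ki; rewrite (PX s).1 1?ltnW// !mxE eqxx/=.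
  by rewrite -val_eqE/= gtn_eqF// mulr0 addr0.
have cX : continuous X.
  move=> s.
  (* [Y s'] moves [X s] along coordinate [k] only, so it agrees with [X s'] from [k] on.
     [partial_zero_dist] bounds their distance by a quantity that tends to 0 as [s'] tends to [s],
     by continuity of [T]. *)
  pose Y s' := X s + (s' - s) *: e.
  have cY : continuous Y.
    move=> s'; apply: cvgD; first exact: cvg_cst.
    apply: cvgZ; last exact: cvg_cst.
    by apply: cvgB; [exact: cvg_id|exact: cvg_cst].
  have Ys : Y s = X s by rewrite /Y subrr scale0r addr0.
  have YX s' : enorm (Y s' - X s') <= enorm (T (Y s') - T (X s)) / c.
    apply: (@partial_zero_dist k _ _ _ _ _ (PX s) (PX s')) => i.
    rewrite leq_eqVlt => /predU1P[ki|ki]; last first.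
      rewrite /Y mxE !Xgt// !mxE eqxx/= -val_eqE/= gtn_eqF// mulr0 addr0//.
    have -> : i = i0 by apply/val_inj.
    by rewrite /Y 3!mxE !eqxx !Xi0 mulr1; lra.
  have cq : continuous (fun s' => enorm (T (Y s') - T (X s))).
    move=> s'.
    apply: (@continuous_comp _ _ _ (fun t => T (Y t) - T (X s)) (@enorm R N)).
      apply: cvgB; last exact: cvg_cst.
      by apply: (@continuous_comp _ _ _ Y T); [exact: cY|exact: cT].
    exact: continuous_enorm.
  have d0 : Y s' - X s' @[s' --> s] --> (0 : 'rV[R]_N).
    apply/norm_cvg0P.
    apply: (@squeeze_cvgr _ _ _ _ (fun=> 0)
      (fun s' => enorm (T (Y s') - T (X s)) / c)).
    - apply: nearW => s'; rewrite normr_ge0/= (le_trans (norm_le_enorm _))//.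
    - exact: cvg_cst.
    - have := cq s; rewrite /continuous_at Ys subrr enorm0 => h.
      have := cvgMr_tmp (b := c^-1) h; rewrite mul0r => {}h; exact: h.
  have XE : (fun s' => Y s' - (Y s' - X s')) = X.
    by apply/funext => s'; rewrite opprB addrC subrK.
  have h : (fun s' => Y s' - (Y s' - X s')) @ s --> X s.
    by have h := cvgB (cY s) d0; rewrite subr0 Ys in h; exact: h.
  by rewrite XE in h.
pose tau s := T (X s) ord0 i0.
have ctau : continuous tau.
  move=> s; apply: cvg_coord.
  by apply: (@continuous_comp _ _ _ X T); [exact: cX|exact: cT].
(* Only coordinate [k] contributes to the pairing: before it [T (X s)] and [T (X s')] vanish, after
   it [X s] and [X s'] coincide. *)
have mtau s s' : c * (s - s') ^+ 2 <= (tau s - tau s') * (s - s').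
  have -> : (tau s - tau s') * (s - s') =
      dotv (T (X s) - T (X s')) (X s - X s').
    rewrite /dotv (bigD1 i0)//= big1 ?addr0; first by rewrite !mxE !Xi0.
    move=> i ii0; rewrite !mxE; have [ik|] := ltnP i k.
      by rewrite (PX s).2// (PX s').2// subrr mul0r.
    rewrite leq_eqVlt => /predU1P[ki|ki]; last by rewrite !Xgt// subrr mulr0.
    by move: ii0; rewrite -val_eqE/= -ki eqxx.
  apply: le_trans (monoT _ _); rewrite ler_pM2l//.
  by apply: le_trans (sqr_coord_le_dotv _ i0); rewrite !mxE !Xi0.
(* Strong monotonicity gives tau(b) >= tau(0) + c b and tau(-b) <= tau(0) - c b; since c b >=
   |tau(0)|, [tau] changes sign on [-b, b]. *)
pose b := `|tau 0| / c + 1.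
have b0 : 0 < b by rewrite ltr_wpDl// divr_ge0// ltW.
have cb : `|tau 0| <= c * b.
  by rewrite mulrDr mulr1 mulrCA divff ?gt_eqF// mulr1 lerDl ltW.
have [] := @IVT R tau (- b) b 0.
- by rewrite (le_trans (ltW _) (ltW b0))// oppr_lt0.
- exact: continuous_subspaceT.
- have tb : 0 <= tau b.
    have := mtau b 0; rewrite subr0 expr2 mulrA ler_pM2r//.
    move: cb; rewrite ler_norml; lra.
  have tNb : tau (- b) <= 0.
    have := mtau 0 (- b); rewrite sub0r opprK expr2 mulrA ler_pM2r//.
    move: cb; rewrite ler_norml; lra.
  by rewrite ge_min tNb le_max tb orbT.
move=> s _ ts; exists (X s); split=> [i ki|i].
  by rewrite Xgt.
rewrite ltnS leq_eqVlt => /predU1P[ik|ik]; last exact: (PX s).2.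
by have -> : i = i0 by exact: val_inj.
Qed.

Lemma strongly_monotone_zero : exists x, T x = 0.
Proof.
have [x [_ Tx]] := partial_zero_exists 0 (leqnn N).
by exists x; apply/rowP => i; rewrite Tx// mxE.
Qed.

End strongly_monotone.

(** * Convex conjugates and monotonicity of their gradients *)

Section convexity.
Context {R : realType} {m : nat}.
Implicit Types (y z : 'rV[R]_m) (f : 'rV[R]_m -> \bar R).

Lemma derive_grad (phi : 'rV[R]_m -> R^o) z v : differentiable phi z ->
  'D_v phi z = dotv (grad phi z) v.
Proof.
move=> dphi; rewrite deriveE// {1}(row_sum_delta v) linear_sum/=.
by apply: eq_bigr => i _; rewrite linearZ/= /grad mxE deriveE// mulrC.
Qed.

(** By convexity the difference quotient at [z] in the direction [y - z] is at most phi(y) - phi(z)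
    for every step in ]0, 1[; the step then tends to 0 from the right. *)
Lemma convex_grad_le (phi : 'rV[R]_m -> R^o) z y : differentiable phi z ->
  (forall t : R, 0 <= t <= 1 ->
    phi (t *: y + (1 - t) *: z) <= t * phi y + (1 - t) * phi z) ->
  phi z + dotv (grad phi z) (y - z) <= phi y.
Proof.
move=> dphi cphi; rewrite addrC -lerBrDr -derive_grad//.
have := @diff_derivable _ _ _ phi z (y - z) dphi.
move=> /cvg_dnbhs_at_right h; apply: (cvgr_to_le h).
near=> t.
have t0 : 0 < t by near: t; exact: nbhs_right_gt.
have t1 : t < 1 by near: t; exact: nbhs_right_lt.
rewrite -[X in X <= _]/(t^-1 * _) mulrC ler_pdivrMr//=.
have -> : t *: (y - z) + z = t *: y + (1 - t) *: z.
  by apply/rowP => i; rewrite !mxE; ring.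
have := cphi t; rewrite (ltW t0) (ltW t1) => /(_ isT).
set a := phi _; lra.
Unshelve. all: by end_near. Qed.

(** The minorant is the tangent at an interior point of the domain, where [f] is finite and
    differentiable. *)
Lemma legendre_affine_minorant f : legendre f ->
  exists a z0 y0, forall y, ((a + dotv z0 (y - y0))%:E <= f y)%E.
Proof.
move=> lf; have [y0 y0int] := legendre_int_dom lf.
have fy0 : f y0 \is a fin_num.
  rewrite fin_numE legendre_gtNy//=; rewrite lt_eqF//.
  exact: interior_subset y0int.
exists (fine (f y0)), (grad (fine \o f) y0), y0 => y.
have := legendre_gtNy lf y; case fy : (f y) => [r| |]// _; last exact: leey.
rewrite lee_fin; have := @convex_grad_le (fine \o f) y0 y; rewrite /= fy; apply.
  exact: legendre_differentiable.
move=> t t01; have := legendre_convex lf y y0 t01.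
rewrite fy -(fineK fy0) -!EFinM -EFinD.
have := legendre_gtNy lf (t *: y + (1 - t) *: y0).
by case: (f (_ + _)).
Qed.

(* [z . y - f y] is negative for large y by supercoercivity, and bounded above
   by the affine minorant elsewhere. *)
Lemma conjugate_fin_num f z : legendre f -> supercoercive f ->
  conjugate f z \is a fin_num.
Proof.
move=> lf sf; rewrite fin_numE; apply/andP; split.
  have [y0 fy0] := legendre_proper lf.
  rewrite -ltNye (@lt_le_trans _ _ ((dotv z y0)%:E - f y0)%E)//.
    have := legendre_gtNy lf y0; move: fy0; rewrite /edom/=.
    by case: (f y0) => // r _ _; rewrite -EFinB ltNyr.
  by apply: ereal_sup_ubound; exists y0.
have [a [z0 [y0 minor]]] := legendre_affine_minorant lf.
(* These constants come from [dotv_le_sum]: [dotv z y] is at most M |y|, and [dotv (z - z0) y] at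
   most M0 |y|. *)
pose M := \sum_i `|z ord0 i|; pose M0 := \sum_i `|(z - z0) ord0 i|.
have [r r0 fr] := sf M.
rewrite -ltey.
apply: (@le_lt_trans _ _ (Num.max 0 (M0 * r - a + dotv z0 y0))%:E);
  last exact: ltry.
apply: ge_ereal_sup => _ [y _ <-].
have [yr|yr] := ltP r (enorm y).
  have y0' : 0 < enorm y by exact: lt_trans yr.
  have := fr _ yr; case fy : (f y) => [s| |].
  - rewrite -EFinM lte_fin ltr_pdivlMr// => h.
    rewrite -EFinB lee_fin le_max; apply/orP; left.
    rewrite subr_le0 (le_trans _ (ltW h))//.
    by rewrite (le_trans (ler_norm _))// dotv_le_sum.
  - by rewrite addeNy leNye.
  - by have := legendre_gtNy lf y; rewrite fy.
have := minor y; case fy : (f y) => [s| |]//; last first.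
  by rewrite addeNy leNye.
rewrite lee_fin => h; rewrite -EFinB lee_fin le_max; apply/orP; right.
have : dotv (z - z0) y <= M0 * r.
  rewrite (le_trans (ler_norm _))// (le_trans (dotv_le_sum _ _))//.
  by rewrite ler_wpM2l// sumr_ge0.
move: h; rewrite dotvDl dotvDr dotvNl dotvNr; lra.
Qed.

(** A conjugate is a supremum of functions affine in [z]. A point [y] with f(y) = +oo contributes
    -oo and can be ignored. *)
Lemma conjugate_convex f z1 z2 (t : R) : legendre f -> supercoercive f ->
  0 <= t <= 1 ->
  fine (conjugate f (t *: z1 + (1 - t) *: z2)) <=
    t * fine (conjugate f z1) + (1 - t) * fine (conjugate f z2).
Proof.
move=> lf sf /andP[t0 t1]; rewrite -lee_fin fineK ?conjugate_fin_num//.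
apply: ge_ereal_sup => _ [y _ <-].
have := legendre_gtNy lf y; case fy : (f y) => [r| |]// _; last first.
  by rewrite addeNy leNye.
have h z : dotv z y - r <= fine (conjugate f z).
  rewrite -lee_fin fineK ?conjugate_fin_num//.
  by apply: ereal_sup_ubound; exists y => //; rewrite fy.
rewrite -EFinB lee_fin dotvDl !dotvZl.
have h1 := ler_wpM2l t0 (h z1).
have t1' : 0 <= 1 - t by rewrite subr_ge0.
have h2 := ler_wpM2l t1' (h z2).
lra.
Qed.

(** Sum of the two gradient inequalities for the conjugate, at [z1] and at [z2]. *)
Lemma grad_conjugate_monotone f z1 z2 : legendre f -> supercoercive f ->
  differentiable (fine \o conjugate f : 'rV[R]_m -> R^o) z1 ->
  differentiable (fine \o conjugate f : 'rV[R]_m -> R^o) z2 ->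
  0 <= dotv (grad (fine \o conjugate f) z1 - grad (fine \o conjugate f) z2)
            (z1 - z2).
Proof.
move=> lf sf d1 d2.
have c1 t : 0 <= t <= 1 -> _ := conjugate_convex z2 z1 lf sf.
have c2 t : 0 <= t <= 1 -> _ := conjugate_convex z1 z2 lf sf.
have := convex_grad_le d1 c1; have := convex_grad_le d2 c2.
rewrite -(opprB z1 z2) dotvNr dotvDl dotvNl /=; lra.
Qed.

End convexity.

(** * Extraction of a basis modulo null vectors *)

Section free_generators.
Context {R : fieldType} {X : lmodType R}.
Variable null : X -> Prop.
Hypothesis null0 : null 0.
Hypothesis nullD : forall x y, null x -> null y -> null (x + y).
Hypothesis nullZ : forall a x, null x -> null (a *: x).

(** As long as some nontrivial combination is null, a generator with nonzero coefficient in it is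
    dropped. [null] will be equality to 0 in V_h and almost everywhere vanishing in W_h, whose
    elements are functions rather than classes. *)
Lemma free_generators (N : nat) (e : 'I_N -> X) :
  exists (N' : nat) (e' : 'I_N' -> X),
  [/\ forall j, exists i, e' j = e i,
      forall c' : 'I_N' -> R, exists c : 'I_N -> R,
        \sum_j c' j *: e' j = \sum_i c i *: e i,
      forall c : 'I_N -> R, exists c' : 'I_N' -> R,
        null (\sum_i c i *: e i - \sum_j c' j *: e' j) &
        forall c : 'I_N' -> R, null (\sum_j c j *: e' j) -> forall j, c j = 0].
Proof.
elim: N e => [|N IH] e.
  by exists 0%N, e; split=> [[]//|c|c|c _ []//]; exists c; rewrite ?subrr.
have [free|] := pselect (forall c : 'I_N.+1 -> R,
    null (\sum_j c j *: e j) -> forall j, c j = 0).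
  exists N.+1, e; split=> // [j|c|c]; first by exists j.
    by exists c.
  by exists c; rewrite subrr.
move=> /existsNP[a] /not_implyP[na] /existsNP[i0 /eqP ai0].
have [N' [e' [e'e sube' spane' freee']]] := IH (fun j => e (lift i0 j)).
exists N', e'; split=> // [j|c'|c].
- by have [i ->] := e'e j; exists (lift i0 i).
- have [c ->] := sube' c'; exists (fun i => oapp c 0 (unlift i0 i)).
  rewrite (bigD1_ord i0)//= unlift_none/= scale0r add0r.
  by apply: eq_bigr => j _; rewrite liftK.
(* Subtracting c(i0) / a(i0) times the null combination [a] cancels the coefficient of the dropped
   generator [i0]. *)
have [c' nc'] := spane' (fun j => c (lift i0 j) - c i0 / a i0 * a (lift i0 j)).
exists c'; have := nullD (nullZ (c i0 / a i0) na) nc'.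
congr null; rewrite addrA; congr (_ - _).
rewrite scaler_sumr !(bigD1_ord i0)//= scalerA divfK// -addrA -big_split/=.
by congr (_ + _); apply: eq_bigr => j _; rewrite scalerBl scalerA addrC subrK.
Qed.

End free_generators.

(** * The nonlinear saddle-point system in coordinates *)

Section saddle_point.
Context {R : realType}.

Lemma dotv_mulmx (n N : nat) (d : 'rV[R]_n) (x : 'rV[R]_N) (M : 'M[R]_(n, N)) :
  dotv (d *m M) x = dotv d (x *m M^T).
Proof.
rewrite /dotv; under eq_bigr do rewrite mxE mulr_suml.
rewrite exchange_big/=; apply: eq_bigr => i _; rewrite mxE mulr_sumr.
by apply: eq_bigr => j _; rewrite mxE -mulrA (mulrC (x _ _)).
Qed.

Lemma continuous_mulmx (n N : nat) (M : 'M[R]_(n, N)) :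
  continuous (mulmx^~ M : 'rV[R]_n -> 'rV[R]_N).
Proof.
have -> : mulmx^~ M = fun x : 'rV[R]_n => \sum_i x ord0 i *: row i M.
  by apply/funext => x; rewrite mulmx_sum_row.
apply: continuous_big => [|i _ x]; first exact: add_continuous.
exact: (cvgZ (@coord_continuous _ _ _ ord0 i x) (cvg_cst _)).
Qed.

(** The quadratic form attains a positive minimum on the compact unit sphere, and homogeneity
    extends the bound to all vectors. No symmetry of [S] enters. *)
Lemma posdef_coercive (N : nat) (S : 'M[R]_N) :
  (forall x, x != 0 -> 0 < dotv (x *m S) x) ->
  exists2 c : R, 0 < c & forall x, c * dotv x x <= dotv (x *m S) x.
Proof.
move=> posS; pose q (x : 'rV[R]_N) := dotv (x *m S) x.
(* If the unit sphere is empty, 0 is the only vector and any constant works. *)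
have [[x0 x01]|noS] := pselect ([set x : 'rV[R]_N | dotv x x = 1] !=set0);
  last first.
  exists 1 => // x; have [->|x0] := eqVneq x 0.
    by rewrite mul0mx !dotv0l mulr0.
  exfalso; apply: noS; exists ((enorm x)^-1 *: x).
  exact: dotv_normalize.
have cq : continuous q.
  apply: continuous_dotv; [exact: continuous_mulmx|move=> ?; exact: cvg_id].
have [|||c cS cmin] := @EVT_min_rV R N q [set x : 'rV[R]_N | dotv x x = 1].
- by exists x0.
- apply: bounded_closed_compact.
    exists 1; split=> // M M1 x /= xx; rewrite (le_trans (norm_le_enorm _))//.
    by rewrite /enorm xx sqrtr1 ltW.
  apply: (@preimage_closed _ _ (fun x : 'rV[R]_N => dotv x x) [set 1]).
    by move=> x _; apply: (@continuous_dotv R N _ id id) => ?; exact: cvg_id.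
  exact: closed_eq.
- exact: continuous_subspaceT.
have c1 : dotv c c = 1 by move: cS; rewrite inE.
exists (q c) => [|x].
  apply: posS; apply: contra_eq_neq c1 => ->.
  by rewrite dotv0l eq_sym oner_neq0.
have [->|x0'] := eqVneq x 0; first by rewrite mul0mx !dotv0l mulr0.
have := cmin ((enorm x)^-1 *: x); rewrite inE => /(_ (dotv_normalize x0')).
rewrite /q -scalemxAl dotvZl dotvZr mulrA -expr2 exprVn -sqr_enorm.
have e0 : 0 < enorm x ^+ 2 by rewrite exprn_even_gt0// enorm_eq0.
by rewrite mulrC ler_pdivlMr.
Qed.

Lemma saddle_point_exists (n N : nat) (A : 'M[R]_n) (B : 'M[R]_(n, N))
    (G : 'rV[R]_N -> 'rV[R]_N) (f : 'rV[R]_n) :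
  (forall d, d != 0 -> 0 < dotv (d *m A) d) ->
  (forall x : 'rV_N, x *m B^T = 0 -> x = 0) ->
  continuous G -> (forall x y, 0 <= dotv (G x - G y) (x - y)) ->
  exists d x, d *m A + x *m B^T = f /\ d *m B = G x.
Proof.
move=> posA injB cG monoG.
have uA : A \in unitmx.
  rewrite -row_free_unit; apply: inj_row_free => d dA0.
  apply: contrapT => /eqP d0; have := posA _ d0.
  by rewrite dA0 dotv0l ltxx.
pose S := B^T *m invmx A *m B.
have [c c0 cS] :
    exists2 c : R, 0 < c & forall x, c * dotv x x <= dotv (x *m S) x.
  (* With d = x B^T A^-1, the form (x S).x equals d.(d A), and d = 0 would force x B^T = 0. *)
  apply: posdef_coercive => x x0; rewrite /S !mulmxA dotv_mulmx.
  set d := x *m B^T *m invmx A.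
  have dA : x *m B^T = d *m A by rewrite /d mulmxKV.
  rewrite dA dotvC posA//; apply: contra x0 => /eqP d0.
  by apply/eqP/injB; rewrite dA d0 mul0mx.
(* Residual of the second equation once the first is solved for [d]; its linear part is [S], which
   makes it strongly monotone. *)
pose T x := G x - (f - x *m B^T) *m invmx A *m B.
have [|||x Tx] := @strongly_monotone_zero R N T c.
- suff cK : continuous (fun x : 'rV[R]_N => (f - x *m B^T) *m invmx A *m B).
    by move=> x; exact: (cvgB (cG x) (cK x)).
  have -> : (fun x => (f - x *m B^T) *m invmx A *m B) =
      fun x => f *m invmx A *m B - x *m (B^T *m invmx A *m B).
    by apply/funext => x; rewrite !mulmxBl !mulmxA.
  move=> x.
  apply: (@cvgB _ _ _ (nbhs x) _ (fun=> f *m invmx A *m B) (mulmx^~ S)).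
    exact: cvg_cst.
  exact: continuous_mulmx.
- by [].
- move=> x y.
  have -> : T x - T y = (G x - G y) + (x - y) *m S.
    rewrite /T /S !mulmxBl !mulmxA.
    set a := G x; set b := G y; set u := f *m _ *m _.
    set v := _ *m B; set w := _ *m B.
    apply/rowP => i; rewrite !mxE; ring.
  by rewrite dotvDl; apply: le_trans (cS _) _; rewrite lerDr.
exists ((f - x *m B^T) *m invmx A), x; split; first by rewrite mulmxKV// subrK.
by apply/esym/eqP; rewrite -subr_eq0 -/(T x) Tx.
Qed.

End saddle_point.

(** * Square-integrable and essentially bounded vector fields *)

Section Lp_theory.
Context d {T : measurableType d} {R : realType}.
Variables (mu : {measure set T -> \bar R}) (D : set T) (m : nat).
Hypothesis mD : measurable D.
Implicit Types (f g h : T -> 'rV[R]_m).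

Local Notation Lp := (@Lp _ _ _ mu D m).
Local Notation "<[ f , g ]>" := (L2_inner mu D f g).
Let coord_measurable f := forall i, measurable_fun D (fun x => f x ord0 i).

Lemma coord_measurableD f g :
  coord_measurable f -> coord_measurable g -> coord_measurable (f + g).
Proof.
move=> mf mg i; under eq_fun do rewrite fctE mxE.
exact: measurable_funD.
Qed.

Lemma coord_measurableZ a f : coord_measurable f -> coord_measurable (a *: f).
Proof.
move=> mf i; under eq_fun do rewrite fctE mxE.
by apply: measurable_funM.
Qed.

Lemma measurable_dotv f g : coord_measurable f -> coord_measurable g ->
  measurable_fun D (fun x => dotv (f x) (g x)).
Proof. by move=> mf mg; apply: measurable_sum => i; exact: measurable_funM. Qed.

Lemma sqr_Lp2_norm f :
  (Lp_norm mu D 2%:E f `^ 2 = \int[mu]_(x in D) (dotv (f x) (f x))%:E)%E.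
Proof.
rewrite /Lp_norm poweR_Lnorm// [RHS]integral_mkcond; apply: eq_integral => x _.
rewrite !patchE; case: ifPn => _ /=; last by rewrite normr0 powR0.
by rewrite ger0_norm ?enorm_ge0// powR_mulrn ?enorm_ge0// sqr_enorm.
Qed.

(** Replaces finiteness of the norm by integrability of |f|^2, the form that the linearity rules of
    the integral require. *)
Lemma Lp2P f : Lp 2%:E f <->
  coord_measurable f /\ mu.-integrable D (fun x => (dotv (f x) (f x))%:E).
Proof.
have int_lty : (Lp_norm mu D 2%:E f < +oo <->
    \int[mu]_(x in D) (dotv (f x) (f x))%:E < +oo)%E.
  rewrite -sqr_Lp2_norm; split; first exact: poweR_lty.
  by apply: lty_poweRy.
split=> [[mf fy]|[mf /integrableP[_ fy]]]; split=> //.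
  apply/integrableP; split; first exact/measurable_EFinP/measurable_dotv.
  rewrite (eq_integral (fun x => (dotv (f x) (f x))%:E)) => [|x _].
    exact/int_lty.
  by rewrite gee0_abs// lee_fin dotv_ge0.
apply/int_lty; move: fy.
rewrite (eq_integral (fun x => (dotv (f x) (f x))%:E))//.
by move=> x _; rewrite gee0_abs// lee_fin dotv_ge0.
Qed.

(** The squares |f + g|^2 and |f - g|^2 being nonnegative, |f.g| is dominated by |f|^2 + |g|^2. *)
Lemma integrable_dotv f g : Lp 2%:E f -> Lp 2%:E g ->
  mu.-integrable D (fun x => (dotv (f x) (g x))%:E).
Proof.
move=> /Lp2P[mf intf] /Lp2P[mg intg].
apply: (le_integrable mD _ _ (integrableD mD intf intg)).
  exact/measurable_EFinP/measurable_dotv.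
move=> x _; rewrite -EFinD !abse_EFin lee_fin [leRHS]ger0_norm; last first.
  by rewrite addr_ge0 ?dotv_ge0.
have := dotv_ge0 (f x + g x); have := dotv_ge0 (f x - g x).
have := dotv_ge0 (f x); have := dotv_ge0 (g x).
rewrite !(dotvDl, dotvDr, dotvNl, dotvNr) (dotvC (g x) (f x)) ler_norml; lra.
Qed.

Lemma Lp2D f g : Lp 2%:E f -> Lp 2%:E g -> Lp 2%:E (f + g).
Proof.
move=> Lf Lg; have [mf _] := Lf; have [mg _] := Lg.
apply/Lp2P; split; first exact: coord_measurableD.
have h1 := integrableD mD (integrable_dotv Lf Lf) (integrable_dotv Lf Lg).
have h2 := integrableD mD (integrable_dotv Lg Lf) (integrable_dotv Lg Lg).
apply: eq_integrable (integrableD mD h1 h2) => // x _.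
by rewrite -!EFinD !fctE dotvDl !dotvDr.
Qed.

Lemma Lp2Z a f : Lp 2%:E f -> Lp 2%:E (a *: f).
Proof.
move=> Lf; have [mf _] := Lf.
apply/Lp2P; split; first exact: coord_measurableZ.
have h := integrableZl mD (a * a) (integrable_dotv Lf Lf).
apply: eq_integrable h => // x _.
by rewrite !fctE dotvZl dotvZr -EFinM mulrA.
Qed.

Lemma Lp2N f : Lp 2%:E f -> Lp 2%:E (- f).
Proof. by rewrite -scaleN1r; exact: Lp2Z. Qed.

Lemma L2_innerC f g : <[f, g]> = <[g, f]>.
Proof. by apply: eq_Rintegral => x _; rewrite dotvC. Qed.

Lemma L2_innerDl f g h : Lp 2%:E f -> Lp 2%:E g -> Lp 2%:E h ->
  <[f + g, h]> = <[f, h]> + <[g, h]>.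
Proof.
move=> Lf Lg Lh; rewrite -RintegralD//; try exact: integrable_dotv.
by apply: eq_Rintegral => x _; rewrite fctE dotvDl.
Qed.

Lemma L2_innerZl a f g : Lp 2%:E f -> Lp 2%:E g -> <[a *: f, g]> = a * <[f, g]>.
Proof.
move=> Lf Lg; rewrite -RintegralZl//; last exact: integrable_dotv.
by apply: eq_Rintegral => x _; rewrite fctE dotvZl.
Qed.

Lemma L2_innerNl f g : Lp 2%:E f -> Lp 2%:E g -> <[- f, g]> = - <[f, g]>.
Proof. by move=> *; rewrite -scaleN1r L2_innerZl// mulN1r. Qed.

Lemma L2_innerDr f g h : Lp 2%:E f -> Lp 2%:E g -> Lp 2%:E h ->
  <[f, g + h]> = <[f, g]> + <[f, h]>.
Proof. by move=> *; rewrite L2_innerC L2_innerDl// !(L2_innerC f). Qed.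

Lemma L2_innerZr a f g : Lp 2%:E f -> Lp 2%:E g -> <[f, a *: g]> = a * <[f, g]>.
Proof. by move=> *; rewrite L2_innerC L2_innerZl// L2_innerC. Qed.

Lemma L2_innerNr f g : Lp 2%:E f -> Lp 2%:E g -> <[f, - g]> = - <[f, g]>.
Proof. by move=> *; rewrite L2_innerC L2_innerNl// L2_innerC. Qed.

Lemma Lp2_0 : Lp 2%:E 0.
Proof.
apply/Lp2P; split=> [i|].
  rewrite (_ : (fun x => _) = fun=> 0); first exact: measurable_cst.
  by apply/funext => x; rewrite mxE.
rewrite (_ : (fun x => _) = cst 0%E); first exact: integrable0.
by apply/funext => x; rewrite dotv0l.
Qed.

Lemma L2_inner0r f : <[f, 0]> = 0.
Proof.
rewrite /L2_inner (_ : (fun x => _) = fun=> 0).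
  by rewrite /Rintegral integral0.
by apply/funext => x; rewrite dotvC dotv0l.
Qed.

Lemma L2_inner_sumr N (c : 'I_N -> R) (e : 'I_N -> T -> 'rV[R]_m) f :
  (forall i, Lp 2%:E (e i)) -> Lp 2%:E f ->
  <[f, \sum_i c i *: e i]> = \sum_i c i * <[f, e i]>.
Proof.
move=> Le Lf.
(* Membership in L^2 is carried along the induction because additivity of the inner product needs
   it. *)
pose P (g : T -> 'rV[R]_m) s := Lp 2%:E g /\ <[f, g]> = s.
suff : P (\sum_i c i *: e i) (\sum_i c i * <[f, e i]>) by case.
apply: (big_ind2 P) => [|f1 s1 f2 s2 [L1 <-] [L2 <-]|i _].
- by split; [exact: Lp2_0|exact: L2_inner0r].
- by split; [exact: Lp2D|rewrite L2_innerDr].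
- by split; [exact: Lp2Z|rewrite L2_innerZr].
Qed.

Lemma eq_L2_innerl f g h : coord_measurable f -> coord_measurable g ->
  coord_measurable h -> f = g %[ae mu in D] -> <[f, h]> = <[g, h]>.
Proof.
move=> mf mg mh fg; congr fine; apply: ae_eq_integral => //.
- exact/measurable_EFinP/measurable_dotv.
- exact/measurable_EFinP/measurable_dotv.
by apply: filterS fg => x /[apply] ->.
Qed.

Lemma eq_L2_innerr f g h : coord_measurable f -> coord_measurable g ->
  coord_measurable h -> f = g %[ae mu in D] -> <[h, f]> = <[h, g]>.
Proof. by move=> mf mg mh fg; rewrite !(L2_innerC h); exact: eq_L2_innerl. Qed.

Lemma L2_inner_ge0_ae f g : coord_measurable f -> coord_measurable g ->
  (\forall x \ae mu, D x -> 0 <= dotv (f x) (g x)) -> 0 <= <[f, g]>.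
Proof.
move=> mf mg fg0.
have -> : <[f, g]> = \int[mu]_(x in D) `|dotv (f x) (g x)|.
  congr fine; apply: ae_eq_integral => //.
  - exact/measurable_EFinP/measurable_dotv.
  - apply/measurable_EFinP; apply: measurableT_comp => //.
    exact: measurable_dotv.
  by apply: filterS fg0 => x /[apply] ?; rewrite ger0_norm.
by apply: Rintegral_ge0.
Qed.

Lemma L2_inner_sqr_lt f eps : Lp 2%:E f -> 0 < eps ->
  (Lp_norm mu D 2%:E f < eps%:E)%E -> <[f, f]> < eps ^+ 2.
Proof.
move=> Lf e0 fe.
have intf := integrable_fin_num mD (integrable_dotv Lf Lf).
rewrite -lte_fin /L2_inner /Rintegral fineK// -sqr_Lp2_norm.
have : (0 <= Lp_norm mu D 2%:E f)%E by exact: Lnorm_ge0.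
case: (Lp_norm _ _ _ _) fe => [r| |]//; rewrite lte_fin lee_fin => re r0.
by rewrite poweR_EFin powR_mulrn// lte_fin ltrXn2r.
Qed.

(** A Cauchy-Schwarz estimate, from the nonnegative squared norm of f + t g at t = s and t = -s,
    where s = eps / (1 + |g|^2). The summand 1 keeps the denominator positive. *)
Lemma L2_inner_small f g eps : Lp 2%:E f -> Lp 2%:E g -> 0 < eps ->
  (Lp_norm mu D 2%:E f < (eps / (1 + <[g, g]>))%:E)%E -> `|<[f, g]>| < eps.
Proof.
move=> Lf Lg e0.
have g0 : 0 <= <[g, g]> by apply: Rintegral_ge0 => x _; exact: dotv_ge0.
set G := 1 + <[g, g]>.
have G0 : 0 < G by rewrite ltr_pwDl.
set s := eps / G => fs.
have s0 : 0 < s by rewrite divr_gt0.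
have ff := L2_inner_sqr_lt Lf s0 fs.
have expand (t : R) : 0 <= <[f, f]> + t * t * <[g, g]> + 2 * (t * <[f, g]>).
  have : 0 <= <[f + t *: g, f + t *: g]>.
    by apply: Rintegral_ge0 => x _; exact: dotv_ge0.
  have Ltg := Lp2Z t Lg; have Lftg := Lp2D Lf Ltg.
  rewrite L2_innerDl// !L2_innerDr// !L2_innerZl// !L2_innerZr//.
  by rewrite (L2_innerC g f); lra.
have eE : eps = s * G by rewrite /s divfK// gt_eqF.
rewrite ltr_norml.
have h1 := expand s; have h2 := expand (- s).
have sG : s ^+ 2 + s * s * <[g, g]> = s * eps by rewrite eE /G; ring.
clearbody s; have se : 0 < s * eps by rewrite mulr_gt0.
have k1 : s * (eps + <[f, g]>) > 0 by lra.
have k2 : s * (eps - <[f, g]>) > 0 by lra.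
by move: k1 k2; rewrite !pmulr_rgt0//; lra.
Qed.

Lemma LpyP f : Lp +oo%E f <-> coord_measurable f /\
  exists M : R, \forall x \ae mu, D x -> enorm (f x) <= M.
Proof.
rewrite /Defs.Lp /Lp_norm Lnorm.unlock /=.
split=> [[mf fy]|[mf [M fM]]]; split=> //.
  (* The L^oo norm is an essential supremum only if the whole space has positive measure; otherwise
     every bound holds almost everywhere. *)
  move: fy; case: ifPn => [mu0 fy|mu0 _]; last first.
    exists 0; exists setT; split=> //.
    by apply/eqP; rewrite eq_le measure_ge0 andbT leNgt.
  have f0 : (0 <= ess_sup mu (abse \o ((EFin \o enorm \o f) \_ D)))%E.
    by apply: ess_sup_gee => //; apply: nearW => x; exact: abse_ge0.
  exists (fine (ess_sup mu (abse \o ((EFin \o enorm \o f) \_ D)))).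
  have := ess_sup_ge mu (abse \o ((EFin \o enorm \o f) \_ D)).
  apply: filterS => x + Dx; rewrite -lee_fin fineK ?ge0_fin_numE//.
  by rewrite /= patchE mem_set//= ger0_norm ?enorm_ge0.
case: ifPn => // mu0.
apply: (@le_lt_trans _ _ (Num.max 0 M)%:E); last exact: ltry.
apply/ess_supP; apply: filterS fM => x fM /=.
rewrite patchE; case: ifPn => [/set_mem Dx|_] /=.
  by rewrite ger0_norm ?enorm_ge0// lee_fin le_max fM ?orbT.
by rewrite normr0 lee_fin le_max lexx.
Qed.

Lemma Lpy_norm_le f (M : R) : 0 <= M ->
  (\forall x \ae mu, D x -> enorm (f x) <= M) -> (Lp_norm mu D +oo f <= M%:E)%E.
Proof.
move=> M0 fM; rewrite /Lp_norm Lnorm.unlock /=; case: ifPn => // _.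
apply/ess_supP; apply: filterS fM => x fM /=.
rewrite patchE; case: ifPn => [/set_mem Dx|_] /=.
  by rewrite ger0_norm ?enorm_ge0// lee_fin fM.
by rewrite normr0 lee_fin.
Qed.

Lemma LpyD f g : Lp +oo%E f -> Lp +oo%E g -> Lp +oo%E (f + g).
Proof.
move=> /LpyP[mf [M fM]] /LpyP[mg [M' gM']]; apply/LpyP; split.
  exact: coord_measurableD.
exists (M + M'); apply: filterS2 fM gM' => x fM gM' Dx.
by rewrite (le_trans (enormD _ _))// lerD// ?fM// gM'.
Qed.

Lemma LpyZ a f : Lp +oo%E f -> Lp +oo%E (a *: f).
Proof.
move=> /LpyP[mf [M fM]]; apply/LpyP; split; first exact: coord_measurableZ.
exists (`|a| * M); apply: filterS fM => x fM Dx.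
by rewrite [leLHS]enormZ ler_wpM2l// fM.
Qed.

Lemma Lpy_sum N (c : 'I_N -> R) (e : 'I_N -> T -> 'rV[R]_m) :
  (forall i, Lp +oo%E (e i)) -> Lp +oo%E (\sum_i c i *: e i).
Proof.
move=> Le; elim/big_ind : _ => [||i _]; [|exact: LpyD|exact: LpyZ].
apply/LpyP; split=> [i|].
  rewrite (_ : (fun x => _) = fun=> 0); first exact: measurable_cst.
  by apply/funext => x; rewrite mxE.
by exists 0; apply: nearW => x _; rewrite [enorm _]enorm0.
Qed.

(** Makes the passage from coordinates, in the sup norm, to functions in L^oo Lipschitz; [M] is the
    sum of essential bounds of the generators. *)
Lemma Lpy_norm_sum N (e : 'I_N -> T -> 'rV[R]_m) :
  (forall i, Lp +oo%E (e i)) -> exists2 M : R, 0 <= M &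
  forall c : 'rV[R]_N,
    (Lp_norm mu D +oo (\sum_i c ord0 i *: e i)%R <= (M * `|c|)%:E)%E.
Proof.
move=> Le.
have /choice[M eM] : forall i, exists M : R,
    \forall x \ae mu, D x -> enorm (e i x) <= M.
  by move=> i; have /LpyP[] := Le i.
exists (\sum_i `|M i|) => [|c]; first by apply: sumr_ge0.
apply: Lpy_norm_le; first by rewrite mulr_ge0// sumr_ge0.
have : \forall x \ae mu, forall i, D x -> enorm (e i x) <= M i.
  exact: filter_forall.
apply: filterS => x eM' Dx.
rewrite fct_sumE mulr_suml.
apply: (@le_trans _ _ (\sum_i enorm (c ord0 i *: e i x))).
  elim/big_ind2 : _ => [|u a v b ua vb|//]; first by rewrite enorm0.
  by rewrite (le_trans (enormD _ _))// lerD.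
apply: ler_sum => i _; rewrite enormZ mulrC ler_pM ?enorm_ge0//.
  by rewrite (le_trans (eM' i Dx))// ler_norm.
rewrite /Num.norm/= mx_normrE.
by apply: (le_bigmax _ (fun ij : 'I_1 * 'I_N => `|c ij.1 ij.2|) (ord0, i)).
Qed.

End Lp_theory.
(** Serves the partial maps of A and b, whose linearity is an equation and not a bundled
    structure. *)
Lemma linear_sum_coef (R : pzRingType) (X : lmodType R) (phi : X -> R)
    (phi_lin : forall a x y, phi (a *: x + y) = a * phi x + phi y)
    (N : nat) (c : 'I_N -> R) (e : 'I_N -> X) :
  phi (\sum_i c i *: e i) = \sum_i c i * phi (e i).
Proof.
have phi0 : phi 0 = 0.
  have := phi_lin (-1) 0 0; rewrite scaler0 addr0 mulN1r => ->.
  by rewrite addNr.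
apply: (big_ind2 (fun x a => phi x = a)) => // [x _ y _ <- <-|i _].
  by rewrite -[x]scale1r phi_lin mul1r scale1r.
by rewrite -[_ *: _]addr0 phi_lin phi0 addr0.
Qed.

(** * Existence and uniqueness for one proximal step *)

Section discrete_step.
Context d {T : measurableType d} {R : realType}.
Variables (mu : {measure set T -> \bar R}) (D : set T) (m : nat).
Hypothesis mD : measurable D.
Variables (V Q : normedModType R).
Variables (A : V -> V -> R) (F : {linear V -> R^o}).
Hypothesis A_linl : forall v a u1 u2, A (a *: u1 + u2) v = a * A u1 v + A u2 v.
Hypothesis A_linr : forall u a v1 v2, A u (a *: v1 + v2) = a * A u v1 + A u v2.
Hypothesis A_pos : forall u, u != 0 -> 0 < A u u.
Variables (iota : Q -> T -> 'rV[R]_m) (B : {linear V -> Q}).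
Hypothesis iotaP : continuous_dense_L2_embedding mu D iota.
Variables (C : T -> set 'rV[R]_m) (Rf : T -> 'rV[R]_m -> \bar R).
Hypothesis RfP :
  \forall x \ae mu, D x -> legendre (Rf x) /\ supercoercive (Rf x).
Hypothesis gradP : grad_conj_convention mu D Rf C.
Variables (Vh : set V) (Wh : set (T -> 'rV[R]_m)).
Hypothesis VhP : fin_dim_subspace Vh.
Hypothesis WhP : fin_dim_Lp_subspace mu D +oo%E Wh.
Hypothesis Lpy_sub_Lp2 : @Lp _ _ _ mu D m +oo%E `<=` @Lp _ _ _ mu D m 2%:E.
Variable mu0 : R.
Hypothesis mu0_gt0 : 0 < mu0.
Hypothesis inf_supP : (mu0%:E < inf_sup mu D iota B Vh Wh)%E.

Local Notation Lp := (@Lp _ _ _ mu D m).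
Local Notation "<[ f , g ]>" := (L2_inner mu D f g).
Local Notation b v w := <[iota (B v), w]>.
Local Notation null f := (f = (0 : T -> 'rV[R]_m) %[ae mu in D]).

(** [iota] is linear only almost everywhere on [D], a difference that the integral does not see. *)
Lemma observation_linear w : Lp 2%:E w ->
  forall a v1 v2, b (a *: v1 + v2) w = a * b v1 w + b v2 w.
Proof.
move=> Lw a v1 v2; have L2 v := L2emb_L2 iotaP (B v).
rewrite linearP -(L2_innerZl mD a (L2 _) Lw).
rewrite -(L2_innerDl mD (Lp2Z mD a (L2 _)) (L2 _) Lw).
apply: eq_L2_innerl => //.
- by case: (L2emb_L2 iotaP (a *: B v1 + B v2)).
- by case: (Lp2D mD (Lp2Z mD a (L2 v1)) (L2 v2)).
- by case: Lw.
- exact: (L2emb_linear iotaP).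
Qed.

(** Otherwise [w] would compete in the infimum, with all its quotients equal to 0; their supremum,
    even over an empty set, could not exceed [mu0]. *)
Lemma inf_sup_injective w : Wh w -> (forall v, Vh v -> b v w = 0) -> null w.
Proof.
move=> Ww bw0; apply: contrapT => w0.
have : (mu0%:E < ereal_sup
    [set ((b v w : R) / (`|v| * dualQ_norm mu D iota w))%R%:E |
     v in [set v | Vh v /\ v != 0%R]])%E.
  by apply: lt_le_trans inf_supP _; apply: ereal_inf_lbound; exists w.
apply/negP; rewrite -leNgt; apply: ge_ereal_sup => _ [v [Vv _] <-].
by rewrite bw0// mul0r lee_fin ltW.
Qed.

Lemma VhB u v : Vh u -> Vh v -> Vh (u - v).
Proof.
have [N [e ->]] := VhP => -[c _ <-] [c' _ <-]; exists (c - c') => //.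
by rewrite -sumrB; apply: eq_bigr => i _; rewrite scalerBl.
Qed.

Lemma WhB f g : Wh f -> Wh g -> Wh (f - g).
Proof.
have [N [e [Le ->]]] := WhP => -[Lf [c fc]] [Lg [c' gc]]; split.
  by rewrite -scaleN1r; apply: LpyD => //; exact: LpyZ.
exists (c - c'); apply: filterS2 fc gc => x fc gc Dx.
rewrite [LHS]/(f x - g x) fc// gc//.
have -> : \sum_i (c - c') i *: e i = \sum_i c i *: e i - \sum_i c' i *: e i.
  by rewrite -sumrB; apply: eq_bigr => i _; rewrite scalerBl.
by [].
Qed.

Lemma Wh_Lpy f : Wh f -> Lp +oo%E f.
Proof. by have [N [e [Le ->]]] := WhP => -[]. Qed.

Lemma Lp2_grad_conj f : Lp +oo%E f -> Lp 2%:E (grad_conj Rf f).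
Proof. by move=> /(grad_conj_feasible gradP)[]. Qed.

Lemma grad_conj_monotone f g : Lp +oo%E f -> Lp +oo%E g ->
  0 <= <[grad_conj Rf f - grad_conj Rf g, f - g]>.
Proof.
move=> Lf Lg; apply: L2_inner_ge0_ae => //.
- by case: (Lp2D mD (Lp2_grad_conj Lf) (Lp2N mD (Lp2_grad_conj Lg))).
- by have [] := LpyD Lf (LpyZ (-1) Lg); rewrite scaleN1r.
have df := grad_conj_wd gradP Lf; have dg := grad_conj_wd gradP Lg.
apply: filterS3 RfP df dg => x Rx dfx dgx Dx.
have [lR sR] := Rx Dx.
exact: grad_conjugate_monotone lR sR (dfx Dx) (dgx Dx).
Qed.

Lemma proximal_step_unique alpha psi_prev u1 psi1 u2 psi2 : 0 < alpha ->
  Wh psi_prev ->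
  proximal_step mu D iota B A F Rf Vh Wh alpha psi_prev u1 psi1 ->
  proximal_step mu D iota B A F Rf Vh Wh alpha psi_prev u2 psi2 ->
  u1 = u2 /\ psi1 = psi2 %[ae mu in D].
Proof.
move=> a0 Wp [V1 W1 prim1 lat1] [V2 W2 prim2 lat2].
have L2W w : Wh w -> Lp 2%:E w by move=> /Wh_Lpy; exact: Lpy_sub_Lp2.
have Li v : Lp 2%:E (iota (B v)) by exact: L2emb_L2 iotaP (B v).
have Vu := VhB V1 V2; have Ww := WhB W1 W2.
(* Subtracting the primal equations cancels F and the previous latent variable. *)
have prim v : Vh v -> alpha * A (u1 - u2) v + b v (psi1 - psi2) = 0.
  move=> Vv; have := prim1 v Vv; have := prim2 v Vv.
  have Lp := L2W _ Wp; have LNp := Lp2N mD Lp.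
  have L1 := L2W _ W1; have L2 := L2W _ W2.
  rewrite (L2_innerDr mD (Li v) L1 LNp) (L2_innerDr mD (Li v) L2 LNp).
  rewrite (L2_innerDr mD (Li v) L1 (Lp2N mD L2)) !(L2_innerNr mD)//.
  have -> : A (u1 - u2) v = A u1 v - A u2 v.
    have := A_linl v (-1) u2 u1.
    by rewrite scaleN1r mulN1r (addrC (- u2)) (addrC (- A u2 v)).
  lra.
have mono := grad_conj_monotone (Wh_Lpy W1) (Wh_Lpy W2).
(* The latent equations turn b(u1 - u2, psi1 - psi2) into the monotonicity pairing, so testing
   [prim] with u1 - u2 leaves A(u1 - u2, u1 - u2) <= 0. *)
have bdu : b (u1 - u2) (psi1 - psi2) =
    <[grad_conj Rf psi1 - grad_conj Rf psi2, psi1 - psi2]>.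
  have := observation_linear (L2W _ Ww) (-1) u2 u1.
  rewrite scaleN1r mulN1r (addrC (- u2)) (addrC (- b u2 _)) => ->.
  move/eqP: (lat1 _ Ww); rewrite subr_eq0 => /eqP ->.
  move/eqP: (lat2 _ Ww); rewrite subr_eq0 => /eqP ->.
  have g1 := Lp2_grad_conj (Wh_Lpy W1); have g2 := Lp2_grad_conj (Wh_Lpy W2).
  rewrite (L2_innerDl mD g1 (Lp2N mD g2) (L2W _ Ww)).
  by rewrite (L2_innerNl mD g2 (L2W _ Ww)).
have du0 : u1 - u2 = 0.
  apply: contrapT => /eqP /A_pos Apos.
  have := prim _ Vu; rewrite bdu; have := mulr_gt0 a0 Apos; lra.
split; first by apply/eqP; rewrite -subr_eq0 du0.
have A0 v : A 0 v = 0.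
  have := A_linl v (-1) 0 0; rewrite scaler0 addr0 mulN1r => ->.
  by rewrite addNr.
have : null (psi1 - psi2).
  apply: inf_sup_injective => // v Vv.
  by have := prim v Vv; rewrite du0 A0 mulr0 add0r.
by apply: filterS => x /[apply] /eqP; rewrite subr_eq0 => /eqP.
Qed.

(** Three continuous maps are composed: coordinates to L^oo, [grad_conj] from L^oo to L^2, and the
    pairing with [g]. *)
Lemma grad_conj_coord_continuous (N : nat) (e : 'I_N -> T -> 'rV[R]_m) g :
  (forall i, Lp +oo%E (e i)) -> Lp 2%:E g ->
  continuous (fun x : 'rV[R]_N => <[grad_conj Rf (\sum_i x ord0 i *: e i), g]>).
Proof.
move=> Le Lg x.
have [M M0 eM] := Lpy_norm_sum Le.
pose psi (y : 'rV[R]_N) := \sum_i y ord0 i *: e i.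
have Lpsi y : Lp +oo%E (psi y) by exact: Lpy_sum.
apply/(cvgrPdist_lt (FF := nbhs_filter x)) => eps eps0.
have G0 : 0 < 1 + <[g, g]>.
  by rewrite ltr_pwDl// Rintegral_ge0// => t _; exact: dotv_ge0.
have eps'0 : 0 < eps / (1 + <[g, g]>) by rewrite divr_gt0.
have [delta delta0 gcont] := grad_conj_continuous gradP (Lpsi x) eps'0.
(* The 1 added to [M] keeps the radius meaningful when M = 0. *)
have near_x : nbhs x (ball x (delta / (M + 1))).
  by apply: nbhsx_ballx; rewrite divr_gt0// ltr_wpDl.
apply: (@filterS _ (nbhs x) (nbhs_filter x) _ _ _ near_x) => y.
rewrite -ball_normE => /= xy.
have L1 := Lp2_grad_conj (Lpsi x); have L2 := Lp2_grad_conj (Lpsi y).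
rewrite distrC -(L2_innerNl mD L1 Lg) -(L2_innerDl mD L2 (Lp2N mD L1) Lg).
apply: (L2_inner_small mD (Lp2D mD L2 (Lp2N mD L1)) Lg eps0).
apply: gcont => //.
have -> : psi y - psi x = \sum_i (y - x) ord0 i *: e i.
  by rewrite -sumrB; apply: eq_bigr => i _; rewrite !mxE scalerBl.
apply: le_lt_trans (eM _) _; rewrite lte_fin distrC.
move: xy; rewrite ltr_pdivlMr ?ltr_wpDl// => xy.
by apply: le_lt_trans xy; rewrite mulrC ler_wpM2l// lerDl.
Qed.

Lemma proximal_step_exists alpha psi_prev : 0 < alpha -> Wh psi_prev ->
  exists u psi, proximal_step mu D iota B A F Rf Vh Wh alpha psi_prev u psi.
Proof.
move=> a0 Wprev.
have Lprev := Lpy_sub_Lp2 (Wh_Lpy Wprev).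
have Li v : Lp 2%:E (iota (B v)) by exact: L2emb_L2 iotaP (B v).
have [n0 [eV0 VhE]] := VhP.
(* The given generators may be dependent; independent ones make the Galerkin matrix positive
   definite. *)
have [|||n [eV [_ eV_sub eV_span eV_free]]] :=
    @free_generators R V (eq^~ 0) _ _ _ n0 eV0.
- by [].
- by move=> x y -> ->; rewrite addr0.
- by move=> a x ->; rewrite scaler0.
have [N0 [eW0 [LeW0 WhE]]] := WhP.
have [|||N [eW [eW_gen eW_sub eW_span eW_free]]] :=
    @free_generators R (T -> 'rV[R]_m) (fun f => null f) _ _ _ N0 eW0.
- exact: nearW.
- by move=> f g; apply: filterS2 => x f0 g0 Dx; rewrite fctE f0// g0// addr0.
- by move=> a f; apply: filterS => x f0 Dx; rewrite fctE f0// scaler0.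
have {eW_gen} LeW k : Lp +oo%E (eW k) by have [i ->] := eW_gen k.
have Le2 k : Lp 2%:E (eW k) by exact: Lpy_sub_Lp2.
pose uu (c : 'rV[R]_n) := \sum_i c ord0 i *: eV i.
pose psi (x : 'rV[R]_N) := \sum_i x ord0 i *: eW i.
have Lpsi x : Lp +oo%E (psi x) by exact: Lpy_sum.
have Vh_uu c : Vh (uu c).
  by rewrite VhE; have [c' c'E] := eV_sub (c ord0); exists c'.
have Wh_psi x : Wh (psi x).
  rewrite WhE; split=> //; have [c' c'E] := eW_sub (x ord0); exists c'.
  by rewrite /psi c'E; exact: nearW.
have Vh_span v : Vh v -> exists c, v = uu c.
  rewrite VhE => -[c _ <-]; have [c' /eqP] := eV_span c.
  rewrite subr_eq0 => /eqP ->; exists (\row_i c' i).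
  by apply: eq_bigr => i _; rewrite mxE.
have Wh_span w : Wh w -> exists x, w = psi x %[ae mu in D].
  rewrite WhE => -[_ [c wc]]; have [c' wc'] := eW_span c.
  exists (\row_i c' i); apply: filterS2 wc wc' => t wc wc' Dt.
  rewrite wc//; apply/eqP; rewrite -subr_eq0.
  have -> : psi (\row_i c' i) = \sum_i c' i *: eW i.
    by apply: eq_bigr => i _; rewrite mxE.
  by apply/eqP; exact: wc'.
have b_psi u x : b u (psi x) = \sum_k x ord0 k * b u (eW k).
  exact: (L2_inner_sumr mD (x ord0) Le2 (Li u)).
have b_uu c w : Lp 2%:E w -> b (uu c) w = \sum_j c ord0 j * b (eV j) w.
  move=> Lw.
  exact: (linear_sum_coef (phi := fun u => b u w) (observation_linear Lw)).
have A_uu c v : A (uu c) v = \sum_i c ord0 i * A (eV i) v.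
  exact: (linear_sum_coef (phi := A^~ v) (A_linl v)).
have A_uur u c : A u (uu c) = \sum_i c ord0 i * A u (eV i).
  exact: (linear_sum_coef (phi := A u) (A_linr u)).
have F_uu c : F (uu c) = \sum_i c ord0 i * F (eV i).
  by rewrite linear_sum; apply: eq_bigr => i _; rewrite linearZ.
(* Coordinates are row vectors. The step size is absorbed in [MA], and the term with [psi_prev] goes
   to the right-hand side. *)
pose MA : 'M[R]_n := \matrix_(i, j) (alpha * A (eV i) (eV j)).
pose MB : 'M[R]_(n, N) := \matrix_(j, k) b (eV j) (eW k).
pose G (x : 'rV[R]_N) : 'rV[R]_N := \row_k <[grad_conj Rf (psi x), eW k]>.
pose rhs : 'rV[R]_n := \row_j (alpha * F (eV j) + b (eV j) psi_prev).
have MAE c j : (c *m MA) ord0 j = alpha * A (uu c) (eV j).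
  rewrite mxE A_uu mulr_sumr; apply: eq_bigr => i _.
  by rewrite mxE mulrCA.
have MBTE x j : (x *m MB^T) ord0 j = b (eV j) (psi x).
  by rewrite mxE b_psi; apply: eq_bigr => k _; rewrite !mxE.
have MBE c k : (c *m MB) ord0 k = b (uu c) (eW k).
  by rewrite mxE b_uu//; apply: eq_bigr => j _; rewrite !mxE.
have [||||c [x [primE latE]]] := @saddle_point_exists R n N MA MB G rhs.
- move=> c c0.
  have -> : dotv (c *m MA) c = alpha * A (uu c) (uu c).
    rewrite A_uur mulr_sumr; apply: eq_bigr => j _.
    by rewrite MAE mulrC mulrCA.
  rewrite mulr_gt0// A_pos//; apply: contra c0 => /eqP /eV_free c0.
  by apply/eqP/rowP => j; rewrite mxE c0.
(* x MB^T = 0 says that b(., psi x) vanishes on V_h: the inf-sup condition makes [psi x] null, and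
   freeness of [eW] makes [x] zero. *)
- move=> x xB0; apply/rowP => k; rewrite mxE; apply: (eW_free (x ord0)).
  apply: inf_sup_injective => [|v /Vh_span[c ->]]; first exact: Wh_psi.
  rewrite -/(psi x) (b_uu c _ (Lpy_sub_Lp2 (Lpsi x))) big1// => j _.
  by rewrite -MBTE xB0 mxE mulr0.
- move=> x.
  have -> : G = fun x =>
      \sum_k <[grad_conj Rf (psi x), eW k]> *: delta_mx ord0 k.
    apply/funext => y; rewrite {1}(row_sum_delta (G y)).
    by apply: eq_bigr => k _; rewrite mxE.
  move: x; apply: continuous_big => [|k _ x]; first exact: add_continuous.
  apply: (@cvgZ _ _ _ (nbhs x) _ (fun x => <[grad_conj Rf (psi x), eW k]>)
                (fun=> delta_mx ord0 k)).
    exact: (grad_conj_coord_continuous LeW (Le2 k)).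
  exact: cvg_cst.
- move=> x y.
  have Lx := Lp2_grad_conj (Lpsi x); have Ly := Lp2_grad_conj (Lpsi y).
  have Lxy := Lp2D mD Lx (Lp2N mD Ly).
  have -> : dotv (G x - G y) (x - y) =
      <[grad_conj Rf (psi x) - grad_conj Rf (psi y), psi x - psi y]>.
    have -> : psi x - psi y = psi (x - y).
      by rewrite -sumrB; apply: eq_bigr => k _; rewrite !mxE scalerBl.
    rewrite (L2_inner_sumr mD ((x - y) ord0) Le2 Lxy); apply: eq_bigr => k _.
    rewrite (L2_innerDl mD Lx (Lp2N mD Ly) (Le2 k)) (L2_innerNl mD Ly (Le2 k)).
    by rewrite mulrC !mxE.
  exact: grad_conj_monotone.
exists (uu c), (psi x); split.
- exact: Vh_uu.
- exact: Wh_psi.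
- move=> v /Vh_span[c' ->].
  have L2x := Lpy_sub_Lp2 (Lpsi x).
  rewrite (L2_innerDr mD (Li _) L2x (Lp2N mD Lprev)).
  rewrite (L2_innerNr mD (Li _) Lprev).
  rewrite addrA; apply/eqP; rewrite subr_eq; apply/eqP.
  rewrite A_uur F_uu !b_uu// !mulr_sumr -!big_split/=; apply: eq_bigr => j _.
  have := congr1 (fun r : 'rV_n => r ord0 j) primE.
  rewrite /= mxE MAE MBTE mxE.
  by move=> h; rewrite mulrCA -mulrDr h mulrDr mulrCA.
(* [w] is only almost everywhere equal to a combination of the [eW k], hence the exchange of
   representatives in both pairings. *)
- move=> w Ww; have [y wy] := Wh_span _ Ww.
  have Lw := Lpy_sub_Lp2 (Wh_Lpy Ww); have Ly := Lpy_sub_Lp2 (Lpsi y).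
  have Lg := Lp2_grad_conj (Lpsi x).
  have mLp f : Lp 2%:E f -> forall i, measurable_fun D (fun x => f x ord0 i).
    by case.
  rewrite (eq_L2_innerr mD (mLp _ Lw) (mLp _ Ly) (mLp _ (Li _)) wy).
  rewrite (eq_L2_innerr mD (mLp _ Lw) (mLp _ Ly) (mLp _ Lg) wy).
  rewrite b_psi (L2_inner_sumr mD (y ord0) Le2 Lg) -sumrB big1// => k _.
  by rewrite -MBE latE mxE subrr.
Qed.
End discrete_step.

(** * The sequence of proximal steps *)

Theorem theorem3p1 (R : realType)
  (* the domain and the constraint set *)
  (n : nat) (hn : (1 <= n <= 3)%N) (m : nat)
  (Omega : set 'rV[R]_n) (hOmega : bounded_lipschitz_domain Omega)
  (d : R) (hd : d <= n%:R)
  (Omega_d : set (hspace R n d)) (mOmega_d : measurable Omega_d)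
  (sOmega_d : Omega_d `<=` closure Omega)
  (dimOmega_d : hausdorff_dim Omega_d = d%:E)
  (* the Hilbert space V and the variational form *)
  (V : completeNormedModType R) (ipV : {dot V for @idfun R})
  (hV : forall v : V, `|v| ^+ 2 = ipV v v)
  (Lop : V -> {linear V -> R^o}) (cLop : forall u, continuous (Lop u))
  (linLop : forall (a : R) (u1 u2 v : V),
    Lop (a *: u1 + u2) v = a * Lop u1 v + Lop u2 v)
  (F : {linear V -> R^o}) (cF : continuous F)
  (c1 Cbnd Ccoerc : R) (hc1 : 0 <= c1) (hCbnd : 0 < Cbnd)
  (hCcoerc : 0 < Ccoerc)
  (hAn : forall u v : V, 2^-1 * (Lop u v - Lop v u) <= c1 * `|u| * `|v|)
  (hA0 : forall u v : V, 2^-1 * (Lop u v + Lop v u) <= Cbnd * `|u| * `|v|)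
  (hAcoerc : forall u : V, Ccoerc * `|u| ^+ 2 <= Lop u u)
  (* the observation map B : V -> Q, with Q embedded in L^2 by iota *)
  (Q : completeNormedModType R)
  (iota : Q -> hspace R n d -> 'rV[R]_m)
  (hiota : continuous_dense_L2_embedding (hmeasure n d) Omega_d iota)
  (B : {linear V -> Q}) (cB : continuous B) (imB : range B = [set: Q])
  (* the constraint and the Legendre function *)
  (C : hspace R n d -> set 'rV[R]_m)
  (hC : \forall x \ae hmeasure n d, Omega_d x ->
    [/\ closed (C x), convex_set (C x : set (convex_lmodType _)) &
        interior (C x) !=set0])
  (Rf : hspace R n d -> 'rV[R]_m -> \bar R)
  (cRf : caratheodory_function (hmeasure n d) Omega_d Rf)
  (hRf : \forall x \ae hmeasure n d, Omega_d x ->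
    [/\ legendre (Rf x), edom (Rf x) = C x & supercoercive (Rf x)])
  (hgrad : grad_conj_convention (hmeasure n d) Omega_d Rf C)
  (* the discretization; mu0 does not depend on Vh and Wh *)
  (mu0 : R) (hmu0 : 0 < mu0)
  (Vh : set V) (hVh : fin_dim_subspace Vh)
  (Wh : set (hspace R n d -> 'rV[R]_m))
  (hWh : fin_dim_Lp_subspace (hmeasure n d) Omega_d +oo%E Wh)
  (hL : @Lp _ _ _ (hmeasure n d) Omega_d m +oo%E
        `<=` @Lp _ _ _ (hmeasure n d) Omega_d m 2%:E)
  (hinfsup : (mu0%:E < inf_sup (hmeasure n d) Omega_d iota B Vh Wh)%E)
  (psi0 : hspace R n d -> 'rV[R]_m) (hpsi0 : Wh psi0)
  (alpha : nat -> R) (halpha : forall k, (1 <= k)%N -> 0 < alpha k) :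
  exists (u : nat -> V) (psi : nat -> hspace R n d -> 'rV[R]_m),
    psi 0%N = psi0 /\
    forall k, (1 <= k)%N ->
      let is_step := proximal_step (hmeasure n d) Omega_d iota B
        (fun u v => Lop u v) F Rf Vh Wh (alpha k) (psi k.-1) in
      is_step (u k) (psi k) /\
      forall u' psi', is_step u' psi' ->
        u' = u k /\ psi' = psi k %[ae hmeasure n d in Omega_d].
Proof.
have A_linr u a v1 v2 : Lop u (a *: v1 + v2) = a * Lop u v1 + Lop u v2.
  by rewrite linearP.
have A_pos u : u != 0 -> 0 < Lop u u.
  move=> u0; apply: lt_le_trans (hAcoerc u).
  by rewrite mulr_gt0// exprn_gt0// normr_gt0.
have RfP : \forall x \ae hmeasure n d, Omega_d x ->
    legendre (Rf x) /\ supercoercive (Rf x).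
  by apply: filterS hRf => x /[apply] -[].
have A_linl v a u1 u2 : Lop (a *: u1 + u2) v = a * Lop u1 v + Lop u2 v.
  exact: linLop.
pose is_step k psi_prev := proximal_step (hmeasure n d) Omega_d iota B
  (fun u v => Lop u v) F Rf Vh Wh (alpha k) psi_prev.
(* The conditions on [s] sit inside the existential, with a dummy pair when they fail, so that
   choice yields a total function. *)
have step_exists (s : nat * (hspace R n d -> 'rV[R]_m)) :
    exists up : V * (hspace R n d -> 'rV[R]_m),
    (1 <= s.1)%N -> Wh s.2 -> is_step s.1 s.2 up.1 up.2.
  have [[k1 Ws]|ns] := pselect ((1 <= s.1)%N /\ Wh s.2); last first.
    by exists (0, s.2) => k1 Ws; exfalso; exact: ns.
  have [u [psi upsi]] := proximal_step_exists mOmega_d F A_linl A_linr A_pos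
    hiota RfP hgrad hVh hWh hL hmu0 hinfsup (halpha _ k1) Ws.
  by exists (u, psi).
have {step_exists} [f fP] := choice step_exists.
pose psi := nat_rect (fun=> hspace R n d -> 'rV[R]_m) psi0
  (fun k psi_k => (f (k.+1, psi_k)).2).
have Wpsi k : Wh (psi k).
  by elim: k => // k Wk; have [] := fP (k.+1, psi k) isT Wk.
(* At k = 0 the primal value is arbitrary: steps are only required from k = 1 on. *)
exists (fun k => (f (k, psi k.-1)).1), psi; split=> // k k1.
have step_k : is_step k (psi k.-1) (f (k, psi k.-1)).1 (psi k).
  by case: k k1 => // k _; exact: (fP (k.+1, psi k) isT (Wpsi k)).
split=> // u' psi' step'.
exact: (proximal_step_unique mOmega_d A_linl A_pos hiota RfP hgrad hVh hWh hL
  hmu0 hinfsup (halpha k k1) (Wpsi k.-1) step' step_k).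
Qed.
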